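(* Let $\alpha,\beta\in[0,1]$ with $\beta\ne\alpha$. If $\alpha\le0.5$ (resp., $\alpha\ge0.5$), then there exists an admissible pair $(\mathrm A,\mathrm B)$ of aggregation functions on $\mathsf{Int}_{[0,1]}$ with $\mathrm A$ strictly Schur-convex (resp., strictly Schur-concave) such that the admissible order $\preceq_{\mathrm A,\mathrm B}$ does not coincide with the $(\alpha,\beta)$-order.
   Context: Let $\mathsf{Int}_{[0,1]}=\{[a_1,a_2]: 0\le a_1\le a_2\le 1\}$ (degenerate intervals allowed); write $\mathbf u=[u_1,u_2]$. The interval order is: $\mathbf u\preceq_{\mathrm{Int}}\mathbf x$ iff $u_1\le x_1$ and $u_2\le x_2$. An admissible order is a total order $\preceq$ on $\mathsf{Int}_{[0,1]}$ such that $\mathbf u\preceq_{\mathrm{Int}}\mathbf x$ implies $\mathbf u\preceq\mathbf x$. An aggregation function (AF) is a function $\mathrm A\colon\mathsf{Int}_{[0,1]}\to[0,1]$ with $\mathrm A([0,0])=0$, $\mathrm A([1,1])=1$, and $\mathrm A(\mathbf u)\le\mathrm A(\mathbf x)$ whenever $u_1\le x_1$ and $u_2\le x_2$. For a pair $(\mathrm A,\mathrm B)$ of AFs, the relation $\preceq_{\mathrm A,\mathrm B}$ is defined by: $\mathbf u\preceq_{\mathrm A,\mathrm B}\mathbf x$ iff $\mathrm A(\mathbf u)<\mathrm A(\mathbf x)$, or $\mathrm A(\mathbf u)=\mathrm A(\mathbf x)$ and $\mathrm B(\mathbf u)\le\mathrm B(\mathbf x)$. The pair $(\mathrm A,\mathrm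 B)$ is admissible if $\preceq_{\mathrm A,\mathrm B}$ is an admissible order. For $w\in[0,1]$, $\mathrm K_w([z_1,z_2])=(1-w)z_1+wz_2$. For $\alpha,\beta\in[0,1]$ with $\alpha\ne\beta$, the $(\alpha,\beta)$-order is the relation $\preceq_{(\alpha,\beta)}$ given by: $\mathbf u\preceq_{(\alpha,\beta)}\mathbf x$ iff $\mathrm K_\alpha(\mathbf u)<\mathrm K_\alpha(\mathbf x)$, or $\mathrm K_\alpha(\mathbf u)=\mathrm K_\alpha(\mathbf x)$ and $\mathrm K_\beta(\mathbf u)\le\mathrm K_\beta(\mathbf x)$. Two relations on $\mathsf{Int}_{[0,1]}$ coincide if they are equal as relations. A function $\mathrm F\colon\mathsf{Int}_{[0,1]}\to\mathbb R$ is strictly Schur-convex (resp., strictly Schur-concave) if $\mathrm F(\mathbf u)<\mathrm F(\mathbf x)$ (resp., $\mathrm F(\mathbf u)>\mathrm F(\mathbf x)$) for all $\mathbf u,\mathbf x\in\mathsf{Int}_{[0,1]}$ with $u_1+u_2=x_1+x_2$ and $u_2<x_2$. *)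

(* Defs.v *)
From HB Require Import structures.
From mathcomp Require Import all_boot all_order all_algebra.
From mathcomp Require Import reals.

Set Implicit Arguments.
Unset Strict Implicit.
Unset Printing Implicit Defensive.

Import Order.TTheory GRing.Theory Num.Theory.
Local Open Scope ring_scope.

Record unitItv (R : realType) := UnitItv {
  lo : R;
  hi : R;
  unitItvP : [&& 0 <= lo, lo <= hi & hi <= 1] }.

Lemma unitItv_degenerate (R : realType) (a : R) :
  0 <= a <= 1 -> [&& 0 <= a, a <= a & a <= 1].
Proof. by case/andP=> -> ->; rewrite lexx. Qed.

Lemma unit_bounds0 (R : realType) : 0 <= (0 : R) <= 1.
Proof. by rewrite lexx ler01. Qed.

Lemma unit_bounds1 (R : realType) : 0 <= (1 : R) <= 1.
Proof. by rewrite lexx ler01. Qed.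

Definition itv00 (R : realType) : unitItv R :=
  UnitItv (unitItv_degenerate (unit_bounds0 R)).

Definition itv11 (R : realType) : unitItv R :=
  UnitItv (unitItv_degenerate (unit_bounds1 R)).

Definition le_Int (R : realType) : rel (unitItv R) :=
  fun u x => (lo u <= lo x) && (hi u <= hi x).

Definition total_order (T : Type) (r : rel T) : Prop :=
  [/\ reflexive r, antisymmetric r, transitive r & total r].

Definition admissible_order (R : realType) (r : rel (unitItv R)) : Prop :=
  total_order r /\ (forall u x, le_Int u x -> r u x).

Definition aggregation_function (R : realType) (A : unitItv R -> R) : Prop :=
  [/\ forall u, 0 <= A u <= 1,
      A (itv00 R) = 0,
      A (itv11 R) = 1
    & forall u x, lo u <= lo x -> hi u <= hi x -> A u <= A x].

Definition pair_rel (R : realType) (A B : unitItv R -> R) : rel (unitItv R) :=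
  fun u x => (A u < A x) || (A u == A x) && (B u <= B x).

Definition admissible_pair (R : realType) (A B : unitItv R -> R) : Prop :=
  [/\ aggregation_function A, aggregation_function B
    & admissible_order (pair_rel A B)].

Definition K (R : realType) (w : R) (z : unitItv R) : R :=
  (1 - w) * lo z + w * hi z.

Definition alpha_beta_order (R : realType) (alpha beta : R) :
    rel (unitItv R) :=
  pair_rel (K alpha) (K beta).

Definition strictly_Schur_convex (R : realType) (F : unitItv R -> R) : Prop :=
  forall u x, lo u + hi u = lo x + hi x -> hi u < hi x -> F u < F x.

Definition strictly_Schur_concave (R : realType) (F : unitItv R -> R) : Prop :=
  forall u x, lo u + hi u = lo x + hi x -> hi u < hi x -> F u > F x.

(* Main.v *)
Require Import Defs.
From HB Require Import structures.
From mathcomp Require Import all_boot all_order all_algebra.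
From mathcomp Require Import reals.
From mathcomp Require Import lra.

Set Implicit Arguments.
Unset Strict Implicit.
Unset Printing Implicit Defensive.

Import Order.TTheory GRing.Theory Num.Theory.
Local Open Scope ring_scope.

(* The two lexicographic orders on endpoints suffice: (hi, lo) in the convex case
   and (lo, hi) in the concave case.  The interval [0, 1] against the point 3/4
   (resp. 1/4) separates them from the (alpha, beta)-order, because
   K_alpha [0, 1] = alpha, while hi [0, 1] = 1 and lo [0, 1] = 0. *)

Lemma unitItv_eq (R : realType) (u x : unitItv R) :
  lo u = lo x -> hi u = hi x -> u = x.
Proof.
case: u x => [a b p] [c d q] /= eac ebd; subst c d.
by rewrite (bool_irrelevance p q).
Qed.

Lemma aggregation_lo (R : realType) : aggregation_function (@lo R).
Proof. by split=> //= -[a b /= /and3P[? ? ?]]; apply/andP; split; lra. Qed.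

Lemma aggregation_hi (R : realType) : aggregation_function (@hi R).
Proof. by split=> //= -[a b /= /and3P[? ? ?]]; apply/andP; split; lra. Qed.

(** Joint injectivity is what antisymmetry needs: mutual comparability forces a tie in [A] and then
    in [B]. Compatibility with [le_Int] comes from monotonicity: [A] either increases strictly or
    ties, and a tie is settled by [B]. *)
Lemma pair_rel_admissible (R : realType) (A B : unitItv R -> R) :
  aggregation_function A -> aggregation_function B ->
  (forall u x, A u = A x -> B u = B x -> u = x) -> admissible_pair A B.
Proof.
move=> aA aB injAB; split=> //.
case: aA aB => [_ _ _ monoA] [_ _ _ monoB]; split; first split.
- by move=> u; rewrite /pair_rel eqxx lexx orbT.
- move=> u x; rewrite /pair_rel; case: ltgtP => //= eqA.
  by move/le_anti; apply: injAB.
- move=> x u z; rewrite /pair_rel.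
  move=> /orP[ltux|/andP[/eqP-> leux]] /orP[ltxz|/andP[/eqP<- lexz]].
  + by rewrite (lt_trans ltux ltxz).
  + by rewrite ltux.
  + by rewrite ltxz.
  + by rewrite eqxx (le_trans leux lexz) orbT.
- by move=> u x; rewrite /pair_rel; case: ltgtP => //= _; apply: le_total.
- move=> u x /andP[lel leh]; rewrite /pair_rel.
  have := monoA _ _ lel leh; rewrite le_eqVlt => /orP[/eqP->|->//].
  by rewrite eqxx monoB ?orbT.
Qed.

Theorem proposition5p3 (R : realType) (alpha beta : R)
    (halpha : 0 <= alpha <= 1) (hbeta : 0 <= beta <= 1)
    (hneq : beta != alpha) :
  (alpha <= 1 / 2 ->
     exists A B : unitItv R -> R,
       [/\ admissible_pair A B, strictly_Schur_convex A
         & ~ (pair_rel A B =2 alpha_beta_order alpha beta)])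
  /\
  (1 / 2 <= alpha ->
     exists A B : unitItv R -> R,
       [/\ admissible_pair A B, strictly_Schur_concave A
         & ~ (pair_rel A B =2 alpha_beta_order alpha beta)]).
Proof.
have [h0 h1 q1 q3] : [/\ [&& 0 <= 0 :> R, 0 <= 1 :> R & 1 <= 1 :> R],
    0 < 1 :> R, 0 <= (1 / 4 : R) <= 1 & 0 <= (3 / 4 : R) <= 1].
  by split; rewrite ?lexx ?ler01 //; apply/andP; split; lra.
pose full := UnitItv h0.
split=> halpha2.
- exists (@hi R), (@lo R); split.
  + apply: pair_rel_admissible (aggregation_hi R) (aggregation_lo R) _.
    by move=> u x eqh eql; apply: unitItv_eq.
  (* For [hi], strict Schur-convexity is its own premise [hi u < hi x]. *)
  + by [].
  (* A point c has [K alpha] equal to c, so any c strictly between 1/2 and 1 serves: [alpha < c]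
     puts [full] strictly below c, while [hi full = 1 > c] forbids this. *)
  + move/(_ full (UnitItv (unitItv_degenerate q3))).
    rewrite /alpha_beta_order /pair_rel /K /=.
    have -> : (1 - alpha) * 0 + alpha * 1
              < (1 - alpha) * (3 / 4) + alpha * (3 / 4) by lra.
    by case: ltgtP => //=; lra.
- exists (@lo R), (@hi R); split.
  + apply: pair_rel_admissible (aggregation_lo R) (aggregation_hi R) _.
    exact: unitItv_eq.
  (* With the sum of endpoints fixed, raising [hi] lowers [lo]. *)
  + by move=> u x eqs lth; lra.
  (* Mirror image: any c strictly between 0 and 1/2 serves, since [c < alpha] puts c strictly below
     [full], while [lo full = 0 < c] forbids this. *)
  + move/(_ (UnitItv (unitItv_degenerate q1)) full).
    rewrite /alpha_beta_order /pair_rel /K /=.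
    have -> : (1 - alpha) * (1 / 4) + alpha * (1 / 4)
              < (1 - alpha) * 0 + alpha * 1 by lra.
    by case: ltgtP => //=; lra.
Qed.
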